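(* Let $n\ge1$ and let $f:\mathbf{M}^n\to\mathbb{Z}$ be submodular. Then for every vertex $\mathbf{x}$ of the polyhedron $P_M(f)$ and every $i\in[n]$, $a\in A$, we have $\mathbf{x}(i,a)\in\{k/2\mid k\in\mathbb{Z}\}$.
   Context: Let $\mathbf{M}$ be a diamond: elements a bottom $0_M$, a top $1_M$, and a finite set $A$ of atoms with $|A|\ge3$, $0_M<a<1_M$ for all $a\in A$, distinct atoms incomparable. $\mathbf{M}^n$ is the product lattice (coordinatewise). $f$ is submodular if $f(\mathbf{s}\wedge\mathbf{t})+f(\mathbf{s}\vee\mathbf{t})\le f(\mathbf{s})+f(\mathbf{t})$ for all $\mathbf{s},\mathbf{t}$. For $\mathbf{x}\in\mathbb{R}^{[n]\times A}$ and $\mathbf{y}\in\mathbf{M}^n$, $\mathbf{x}(\mathbf{y})=\sum_{i=1}^n g_i$ with $g_i=0$ if $\mathbf{y}(i)=0_M$, $g_i=\mathbf{x}(i,\mathbf{y}(i))$ if $\mathbf{y}(i)\in A$, $g_i=\max_{a\ne a'\in A}(\mathbf{x}(i,a)+\mathbf{x}(i,a'))$ if $\mathbf{y}(i)=1_M$. $P_M(f)=\{\mathbf{x}\in\mathbb{R}^{[n]\times A}\mid \mathbf{x}(\mathbf{y})\le f(\mathbf{y})\ \forall\mathbf{y}\in\mathbf{M}^n\}$; this is a polyhedron. *)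

(* Defs.v *)
From HB Require Import structures.
From mathcomp Require Import all_boot all_order all_algebra.
From mathcomp Require Import classical_sets reals.

Set Implicit Arguments.
Unset Strict Implicit.
Unset Printing Implicit Defensive.

Import Order.TTheory GRing.Theory Num.Theory.

Local Open Scope ring_scope.

Inductive diamond (A : Type) : Type := DBot | DAtom of A | DTop.

Arguments DBot {A}.
Arguments DTop {A}.

Fact diamond_display : Order.disp_t.
Proof. exact: (Order.Disp tt tt). Qed.

Section DiamondLattice.
Variable A : finType.
Implicit Types u v w : diamond A.

Definition diamond_code u : option (option A) :=
  match u with DBot => None | DAtom a => Some (Some a) | DTop => Some None end.

Definition diamond_decode (c : option (option A)) : diamond A :=
  match c with
  | None => DBot | Some (Some a) => DAtom a | Some None => DTop
  end.

Lemma diamond_codeK : cancel diamond_code diamond_decode.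
Proof. by case. Qed.

HB.instance Definition _ := Finite.copy (diamond A) (can_type diamond_codeK).

Definition diamond_le u v : bool :=
  match u, v with
  | DBot, _ | _, DTop => true
  | DAtom a, DAtom b => a == b
  | _, _ => false
  end.

Definition diamond_meet u v : diamond A :=
  match u, v with
  | DTop, w | w, DTop => w
  | DAtom a, DAtom b => if a == b then DAtom a else DBot
  | _, _ => DBot
  end.

Definition diamond_join u v : diamond A :=
  match u, v with
  | DBot, w | w, DBot => w
  | DAtom a, DAtom b => if a == b then DAtom a else DTop
  | _, _ => DTop
  end.

Lemma diamond_le_refl : reflexive diamond_le.
Proof. by case=> //= a; exact: eqxx. Qed.

Lemma diamond_le_anti : antisymmetric diamond_le.
Proof. by case=> [|a|] [|b|] //= /andP[/eqP-> _]. Qed.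

Lemma diamond_le_trans : transitive diamond_le.
Proof. by case=> [|a|] [|b|] [|c|] //= /eqP->. Qed.

HB.instance Definition _ := Order.Le_isPOrder.Build diamond_display (diamond A)
  diamond_le_refl diamond_le_anti diamond_le_trans.

Lemma diamond_meetP u v w :
  (u <= diamond_meet v w)%O = (u <= v)%O && (u <= w)%O.
Proof.
rewrite /Order.le /=; case: v w => [|b|] [|c|] /=; rewrite ?andbb;
  try by case: u => //= a; rewrite ?andbT ?andbF.
have [->|nbc] := eqVneq b c; first by rewrite andbb.
case: u => //= a; case: (eqVneq a b) => //= ->.
by rewrite (negPf nbc).
Qed.

Lemma diamond_joinP u v w :
  (diamond_join u v <= w)%O = (u <= w)%O && (v <= w)%O.
Proof.
rewrite /Order.le /=; case: u v => [|a|] [|b|] /=; rewrite ?andbb ?andbT //;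
  try by case: w => //= c; rewrite ?andbT ?andbF.
have [->|nab] := eqVneq a b; first by rewrite andbb.
case: w => //= c; case: (eqVneq a c) => //= <-.
by rewrite eq_sym (negPf nab).
Qed.

HB.instance Definition _ := Order.POrder_MeetJoin_isLattice.Build
  diamond_display (diamond A) diamond_meetP diamond_joinP.

Lemma diamond_le0x u : (DBot <= u)%O. Proof. by []. Qed.

Lemma diamond_lex1 u : (u <= DTop)%O. Proof. by case: u. Qed.

HB.instance Definition _ :=
  Order.hasBottom.Build diamond_display (diamond A) diamond_le0x.
HB.instance Definition _ :=
  Order.hasTop.Build diamond_display (diamond A) diamond_lex1.

End DiamondLattice.

Definition submodular (d : Order.disp_t) (L : latticeType d) (f : L -> int) : Prop :=
  forall s t : L, f (s `&` t)%O + f (s `|` t)%O <= f s + f t.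

Section Polyhedron.
Variables (R : realType) (n : nat) (A : finType).

Definition dvec := {ffun 'I_n * A -> R}.

Definition pair_sums (x : dvec) (i : 'I_n) : seq R :=
  [seq x (i, p.1) + x (i, p.2) | p <- enum {: A * A} & p.1 != p.2].

(* [head 0] only supplies a starting value taken from the family itself, so
   this is the genuine maximum as soon as [A] has two elements: see
   [max_pair_ge] and [max_pair_attained]. *)
Definition max_pair (x : dvec) (i : 'I_n) : R :=
  \big[Num.max/head 0 (pair_sums x i)]_(v <- pair_sums x i) v.

Definition dval_at (x : dvec) (i : 'I_n) (u : diamond A) : R :=
  match u with
  | DBot => 0
  | DAtom a => x (i, a)
  | DTop => max_pair x i
  end.

Definition dval (x : dvec) (y : n.-tupleprod (diamond A)) : R :=
  \sum_(i < n) dval_at x i (tnth y i).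

Definition PM (f : n.-tupleprod (diamond A) -> int) : set dvec :=
  [set x : dvec | forall y, dval x y <= (f y)%:~R].

Lemma pair_sumsP (x : dvec) (i : 'I_n) (v : R) :
  v \in pair_sums x i <-> exists a b : A, a != b /\ v = x (i, a) + x (i, b).
Proof.
split=> [/mapP[[a b]] | [a [b [nab ->]]]].
  by rewrite mem_filter /= => /andP[nab _] ->; exists a, b.
by apply/mapP; exists (a, b); rewrite // mem_filter mem_enum /= nab.
Qed.

Lemma max_pair_ge (x : dvec) (i : 'I_n) (a b : A) :
  a != b -> x (i, a) + x (i, b) <= max_pair x i.
Proof.
move=> nab; rewrite /max_pair.
suff xs : x (i, a) + x (i, b) \in pair_sums x i.
  exact: (le_bigmax_seq _ _ xpredT id).
by apply/pair_sumsP; exists a, b.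
Qed.

Lemma max_pair_attained (x : dvec) (i : 'I_n) :
  (1 < #|A|)%N ->
  exists a b : A, a != b /\ max_pair x i = x (i, a) + x (i, b).
Proof.
move=> /card_gt1P[a0 [b0 [_ _ nab0]]]; apply/pair_sumsP.
have : x (i, a0) + x (i, b0) \in pair_sums x i.
  by apply/pair_sumsP; exists a0, b0.
rewrite /max_pair; case: (pair_sums x i) => [//|v s] _ /=.
rewrite big_seq; elim/big_ind: _ => //=; first by rewrite mem_head.
by move=> p q ps qs; rewrite maxEle; case: ifP.
Qed.

End Polyhedron.

(* A vertex is a point of [P] that is not a proper convex combination of two
   other points of [P]. *)
Definition vertex (R : realType) (I : finType) (P : set {ffun I -> R})
    (x : {ffun I -> R}) : Prop :=
  P x /\ forall (y z : {ffun I -> R}) (t : R), P y -> P z -> 0 < t < 1 ->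
    x = [ffun p => t * y p + (1 - t) * z p] -> y = x /\ z = x.

(* Main.v *)
Require Import Defs.
From HB Require Import structures.
From mathcomp Require Import all_boot all_order all_algebra.
From mathcomp Require Import classical_sets reals.
From mathcomp Require Import zify ring lra.

Set Implicit Arguments.
Unset Strict Implicit.
Unset Printing Implicit Defensive.

Import Order.TTheory GRing.Theory Num.Theory.

Local Open Scope ring_scope.

(* Let T be the set of elements y at which the constraint x(y) <= f(y) is tight.
   The map y |-> x(y) is supermodular, so T is a sublattice, and two distinct
   atoms that occur in T at the same coordinate i form a pair attaining the
   maximum in the value of the top at i.  Since x is a vertex, every direction
   that keeps all tight constraints vanishes.  Hence T contains the all-top
   element, and at every coordinate x takes one value on all atoms but at most
   one.  So x is determined by at most two parameters per coordinate, and a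
   direction in these parameters is a modular function on T.

   A modular function that vanishes on a maximal chain of T vanishes on T, so
   the parameters are the unique solution of the integral linear system given by
   the successive differences along such a chain.  The coefficient of a
   parameter is 0 at the bottom, 0 or 1 at an atom and at most 2 at the top, so
   its total variation along the chain, i.e. the l1-norm of its column, is at
   most 2.  A uniquely solvable integral system with this property has a
   half-integral solution: pivoting on an entry +-1 preserves the column bound,
   and a system without such entries reads +-2 w_e = c_e. *)

(** * Half-integrality of integral systems with columns of norm at most 2 *)

Lemma mulz_norm1 (z : int) : `|z| = 1 -> z * z = 1.
Proof. by move=> z1; have [->|->] : z = 1 \/ z = -1 by lia. Qed.

Lemma normz_eq2 (z s : int) :
  z != 0 -> `|z| != 1 -> 0 <= s -> `|z| + s <= 2 ->
  (z = 2 \/ z = - 2) /\ s = 0.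
Proof. by lia. Qed.

Section HalfIntegral.
Variables (R : archiRealFieldType) (E : finType).
Implicit Types (S : {set E}) (rows : seq {ffun E -> int}) (r q : {ffun E -> int})
  (d x : E -> R).

Definition rdot S r d : R := \sum_(e in S) (r e)%:~R * d e.

Lemma rdotD1 S e r d : e \in S ->
  rdot S r d = (r e)%:~R * d e + rdot (S :\ e) r d.
Proof. by move=> eS; rewrite /rdot (big_setD1 e). Qed.

Lemma rdotB S r r' c d :
  rdot S [ffun e => r e - c * r' e] d = rdot S r d - c%:~R * rdot S r' d.
Proof.
rewrite /rdot mulr_sumr -sumrB; apply: eq_bigr => e _.
by rewrite ffunE intrB intrM; ring.
Qed.

Lemma eq_rdot S r d d' : {in S, d =1 d'} -> rdot S r d = rdot S r d'.
Proof. by move=> eqd; apply: eq_bigr => e eS; rewrite eqd. Qed.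

(** Unique solvability is expressed as a trivial kernel on [S]; the right-hand side is whatever [x]
    produces. *)
Definition half_integral_system rows S x : Prop :=
  [/\ {in S, forall e, \sum_(r <- rows) `|r e| <= 2},
      forall d, {in rows, forall r, rdot S r d = 0} ->
        {in S, forall e, d e = 0}
    & {in rows, forall r, rdot S r x \is a Num.int}].

(** Row [r] takes 1 of the norm of column [e], so the other [|q e|] sum to at most 1. Hence what the
    elimination adds to column [e'] is paid for by the removed entry [|r e'|]. *)
Lemma half_integral_pivot rows S x r e :
    r \in rows -> e \in S -> `|r e| = 1 -> half_integral_system rows S x ->
  half_integral_system
    [seq [ffun e' => q e' - q e * r e * r e']
      | q : {ffun E -> int} <- rem r rows]
    (S :\ e) x.
Proof.
move=> rrows eS re1 [l1 ker intx].
have re2 : r e * r e = 1 by rewrite mulz_norm1.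
split.
- move=> e' /setD1P[ne'e e'S]; rewrite big_map.
  apply: le_trans (l1 _ e'S); rewrite [leRHS](big_rem _ rrows) /=.
  apply: (@le_trans _ _ (\sum_(q <- rem r rows) (`|q e'| + `|q e| * `|r e'|))).
    apply: ler_sum => q _; rewrite ffunE.
    by apply: le_trans (ler_normB _ _) _; rewrite !normrM re1 mulr1.
  rewrite big_split /= addrC lerD2r -mulr_suml.
  have := l1 _ eS; rewrite (big_rem _ rrows) /= re1.
  set s := \sum_(_ <- _) _ => s1.
  by rewrite -[leRHS]mul1r; apply: ler_wpM2r => //; lia.
- move=> d zd e' /setD1P[ne'e e'S].
  (* The value at [e] is the one that makes row [r] vanish. *)
  pose d' t := if t == e then - (r e)%:~R * rdot (S :\ e) r d else d t.
  have dd' q : rdot (S :\ e) q d' = rdot (S :\ e) q d.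
    by apply: eq_rdot => t /setD1P[te _]; rewrite /d' (negPf te).
  have reR : (r e)%:~R * (r e)%:~R = 1 :> R by rewrite -intrM re2.
  have d'0 q : q \in rows -> rdot S q d' = 0.
    move=> qrows; rewrite (rdotD1 _ _ eS) dd' {1}/d' eqxx.
    have [->|nqr] := eqVneq q r; first by rewrite mulNr mulrN mulrA reR; ring.
    have qrem : q \in rem r rows.
      have := perm_to_rem rrows => /perm_mem/(_ q).
      by rewrite qrows in_cons (negPf nqr).
    have := zd _ (map_f _ qrem); rewrite rdotB intrM => <-; ring.
  by have := ker _ d'0 e' e'S; rewrite /d' (negPf ne'e).
- move=> _ /mapP[q /mem_rem qrows ->]; rewrite rdotB intrM.
  have -> : rdot (S :\ e) q x - (q e)%:~R * (r e)%:~R * rdot (S :\ e) r x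
     = rdot S q x - (q e)%:~R * (r e)%:~R * rdot S r x.
    rewrite !(rdotD1 _ _ eS).
    have reR : (r e)%:~R * (r e)%:~R = 1 :> R by rewrite -intrM re2.
    by ring: reR.
  by rewrite rpredB ?rpredM ?intr_int // intx.
Qed.

Lemma half_integral rows S x : half_integral_system rows S x ->
  {in S, forall e, 2 * x e \is a Num.int}.
Proof.
move: {2}(size rows) (erefl (size rows)) => m.
elim: m rows S => [|m IHm] rows S szr sys; have [l1 ker intx] := sys.
  case: rows szr l1 ker {intx sys} => // _ _ ker e eS.
  by rewrite (ker x) ?mulr0 ?rpred0.
have [[r rrows]|] :=
  altP (@hasP _ (fun r => [exists e in S, `|r e| == 1]) rows).
  case/existsP=> e0 /andP[e0S /eqP re1].
  have /IHm IH := half_integral_pivot rrows e0S re1 sys.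
  have {}IH : {in S :\ e0, forall e, 2 * x e \is a Num.int}.
    by apply: IH; rewrite size_map size_rem // szr.
  move=> e eS; have [->{e eS}|ne] := eqVneq e e0; last first.
    by apply: IH; rewrite in_setD1 ne.
  have re2 : (r e0)%:~R * (r e0)%:~R = 1 :> R.
    by rewrite -intrM mulz_norm1.
  have := intx _ rrows; rewrite (rdotD1 _ _ e0S) => rx.
  (* Row [r] is solved for [x e0], its coefficient being its own inverse. *)
  have -> : 2 * x e0 =
      (r e0)%:~R * (2 * ((r e0)%:~R * x e0 + rdot (S :\ e0) r x)
     - 2 * rdot (S :\ e0) r x).
    by ring: re2.
  rewrite rpredM ?intr_int // rpredB //; first by rewrite rpredM ?rpred_nat.
  rewrite /rdot mulr_sumr.
  by apply: rpred_sum => e eS; rewrite mulrCA rpredM ?intr_int ?IH.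
move=> /hasPn no1 e eS.
have no1' q t : q \in rows -> t \in S -> `|q t| != 1.
  move=> /no1; rewrite negb_exists => /forallP/(_ t).
  by rewrite negb_and => /orP[/negP//|].
(* With no entries of absolute value 1 left, a nonzero entry is 2 or -2 and exhausts its column. *)
have single q t : q \in rows -> t \in S -> q t != 0 ->
    (q t = 2 \/ q t = - 2) /\ forall q', q' \in rem q rows -> q' t = 0.
  move=> qr tS qt0; have := l1 _ tS; rewrite (big_rem _ qr) /= => le2.
  have s0 : 0 <= \sum_(q' <- rem q rows) `|q' t| by apply: sumr_ge0.
  have [qt2 s00] := normz_eq2 qt0 (no1' _ _ qr tS) s0 le2; split=> // q' q'r.
  apply/eqP; rewrite -normr_eq0; move/eqP: s00; rewrite (big_rem _ q'r) /=.
  by rewrite paddr_eq0 ?sumr_ge0 // => /andP[].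
have [/hasP[r rr re0]|/hasPn all0] :=
    boolP (has (fun r => r e != 0) rows); last first.
  (* A zero column [e] would put the indicator of [e] in the kernel. *)
  have /(_ e eS) : {in S, forall t, (t == e)%:R = 0 :> R}.
    apply: ker => q qr; rewrite (rdotD1 _ _ eS) eqxx mulr1.
    rewrite (eqP (negPn (all0 _ qr))) add0r /rdot big1 // => t /setD1P[te _].
    by rewrite (negPf te) mulr0.
  by rewrite eqxx => /eqP; rewrite oner_eq0.
have [re2 rest0] := single _ _ rr eS re0.
have z0 t : t \in S :\ e -> r t = 0.
  move=> /setD1P[te tS]; apply/eqP/negPn/negP => rt0.
  have [_ rest0'] := single _ _ rr tS rt0.
  (* Columns [e] and [t] are both supported on row [r], so they would be linearly dependent. *)
  pose d s : R :=
    if s == e then (r t)%:~R else if s == t then - (r e)%:~R else 0.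
  have /(_ t tS) : {in S, forall s, d s = 0}.
    apply: ker => q qr.
    rewrite (rdotD1 _ _ eS) (@rdotD1 _ t) ?in_setD1 ?te //.
    rewrite /rdot big1 ?addr0; last first.
      move=> s /setD1P[st /setD1P[se _]].
      by rewrite /d (negPf se) (negPf st) mulr0.
    rewrite /d !eqxx (negPf te).
    have [->|nqr] := eqVneq q r; first by ring.
    have qrem : q \in rem r rows.
      have := perm_to_rem rr => /perm_mem/(_ q).
      by rewrite qr in_cons (negPf nqr).
    by rewrite rest0 // rest0' // !mul0r addr0.
  by rewrite /d (negPf te) eqxx => /eqP; rewrite oppr_eq0 intr_eq0 (negPf re0).
have := intx _ rr; rewrite (rdotD1 _ _ eS) /rdot big1 ?addr0; last first.
  by move=> t /z0 ->; rewrite mul0r.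
case: re2 => ->; first by [].
by rewrite intrN mulNr rpredN.
Qed.

End HalfIntegral.

(** * Telescoping along a sequence *)

Section Pairmap.
Variables (T Q : eqType) (F : T -> T -> Q).

Lemma mem_pairmap y s r : r \in pairmap F y s ->
  exists u v, [/\ u \in y :: s, v \in y :: s & r = F u v].
Proof.
elim: s y => //= z s IHs y; rewrite in_cons => /orP[/eqP ->|/IHs].
  by exists y, z; rewrite !in_cons !eqxx orbT.
move=> [u [v [us vs ->]]]; exists u, v.
by split=> //; rewrite in_cons ?us ?vs orbT.
Qed.

(** [phi] serves as a potential: its increments bound the terms and telescope. *)
Lemma sum_pairmap_le (e : rel T) (h : Q -> int) (phi : T -> int) y s :
    (forall u v, e u v -> h (F u v) <= phi v - phi u) -> path e y s ->
  \sum_(r <- pairmap F y s) h r <= phi (last y s) - phi y.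
Proof.
move=> hF; elim: s y => [|z s IHs] y /=; first by rewrite big_nil subrr.
by move=> /andP[/hF le_yz /IHs le_z]; rewrite big_cons; lra.
Qed.

Lemma pairmap_eq0 (V : zmodType) (G : Q -> V) (D : T -> V) y s :
    (forall u v, G (F u v) = D v - D u) -> D y = 0 ->
    {in pairmap F y s, forall r, G r = 0} ->
  {in y :: s, forall z, D z = 0}.
Proof.
move=> GF; elim: s y => [|z s IHs] y Dy0 /= G0 w; rewrite in_cons.
  by rewrite orbF => /eqP ->.
move=> /orP[/eqP-> //|]; apply: IHs.
  by have := G0 _ (mem_head _ _); rewrite GF Dy0 subr0.
by move=> r rs; apply: G0; rewrite in_cons rs orbT.
Qed.

End Pairmap.

(** * Maximal chains and modular functions on a sublattice *)

Section MaximalChain.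
Variables (disp : Order.disp_t) (L : finLatticeType disp) (T : pred L).
Implicit Types (y z w : L) (s : seq L).

(** The case [y = z] is allowed; only elements of [T] strictly in between are excluded. *)
Definition cover_in y z : bool :=
  (y <= z)%O && [forall w, T w && (y <= w <= z)%O ==> (w == y) || (w == z)].

Lemma maximal_chain y top : T y -> T top -> (forall w, T w -> (w <= top)%O) ->
  exists s, [/\ path cover_in y s, all T s & last y s = top].
Proof.
move=> Ty Ttop le_top.
have [k] := ubnP #|[set z | T z && (y < z)%O]|.
elim: k y Ty => // k IHk y Ty; rewrite ltnS => le_k.
have [->|ne_y] := eqVneq y top; first by exists [::].
have lt_y : T top && (y < top)%O by rewrite Ttop lt_neqAle ne_y le_top.
(* Minimising the size of the strict down-set yields a minimal element of [T] above [y]. *)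
have [z /andP[Tz lt_yz] z_min] :=
  @arg_minnP _ top (fun z => T z && (y < z)%O)
    (fun z => #|[set w | (w < z)%O]|) lt_y.
have [|s [ps Ts last_s]] := IHk z Tz.
  apply: leq_trans le_k; apply: proper_card; apply/properP; split.
    by apply/fintype.subsetP => w; rewrite !inE => /andP[-> /(lt_trans lt_yz)].
  by exists z; rewrite !inE Tz ?ltxx.
exists (z :: s); rewrite /= Tz; split=> //; rewrite ps andbT /cover_in ltW //=.
apply/forallP => w; apply/implyP => /andP[Tw /andP[le_yw le_wz]].
apply/norP => -[ne_wy ne_wz].
have lt_yw : (y < w)%O by rewrite lt_neqAle eq_sym ne_wy.
have lt_wz : (w < z)%O by rewrite lt_neqAle ne_wz.
have := z_min w; rewrite Tw lt_yw => /(_ isT); apply/negP; rewrite -ltnNge.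
apply: proper_card; apply/properP; split.
  by apply/fintype.subsetP => u; rewrite !inE => /lt_trans; apply.
by exists w; rewrite !inE ?ltxx.
Qed.

Hypothesis T_meet : forall y z, T y -> T z -> T (y `&` z)%O.
Hypothesis T_join : forall y z, T y -> T z -> T (y `|` z)%O.

Lemma exists_least y1 : T y1 -> exists2 y, T y & forall w, T w -> (y <= w)%O.
Proof.
move=> Ty1; have [y Ty y_min] :=
  @arg_minnP _ y1 T (fun z => #|[set w | (w < z)%O]|) Ty1.
exists y => // w Tw; rewrite leEmeet; apply/negPn/negP => ne.
have lt_y : (y `&` w < y)%O by rewrite lt_neqAle ne leIl.
have := y_min _ (T_meet Ty Tw); apply/negP; rewrite -ltnNge.
apply: proper_card; apply/properP; split.
  by apply/fintype.subsetP => u; rewrite !inE => /lt_trans; apply.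
by exists (y `&` w)%O; rewrite !inE ?ltxx.
Qed.

Lemma exists_greatest y1 : T y1 -> exists2 y, T y & forall w, T w -> (w <= y)%O.
Proof.
move=> Ty1; have [y Ty y_min] :=
  @arg_minnP _ y1 T (fun z => #|[set w | (z < w)%O]|) Ty1.
exists y => // w Tw; rewrite leEjoin joinC; apply/negPn/negP => ne.
have lt_y : (y < y `|` w)%O by rewrite lt_neqAle eq_sym ne leUl.
have := y_min _ (T_join Ty Tw); apply/negP; rewrite -ltnNge.
apply: proper_card; apply/properP; split.
  by apply/fintype.subsetP => u; rewrite !inE; apply: lt_trans.
by exists (y `|` w)%O; rewrite !inE ?ltxx.
Qed.

Variables (V : zmodType) (D : L -> V).
Hypothesis D_modular : forall y z, T y -> T z ->
  D (y `&` z)%O + D (y `|` z)%O = D y + D z.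

(** For a link from [y] to [z], the element [y] joined with the meet of [w] and [z] lies in [T]
    between them, so it is one of them and [D] vanishes there. Modularity then lets [z] be replaced
    by [y] in the meet with [w]. *)
Lemma modular_chain_eq0 y s : T y -> all T s -> path cover_in y s ->
    {in y :: s, forall z, D z = 0} ->
  forall w, T w -> D (w `&` last y s)%O = D (w `&` y)%O.
Proof.
elim: s y => //= z s IHs y Ty /andP[Tz Ts] /andP[/andP[le_yz cov] ps] D0 w Tw.
rewrite IHs // => [|u us]; last by apply: D0; rewrite in_cons us orbT.
have Tu := T_meet Tw Tz; have Tv := T_join Ty Tu.
have Dv : D (y `|` (w `&` z))%O = 0.
  move/forallP/(_ (y `|` (w `&` z))%O): cov.
  rewrite Tv leUl leUx le_yz leIr /= => /orP[]/eqP->; apply: D0;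
  by rewrite !in_cons eqxx ?orbT.
have := D_modular Ty Tu; rewrite Dv (D0 y) ?mem_head // addr0 add0r => <-.
by rewrite meetCA (meet_idPl le_yz).
Qed.

End MaximalChain.

(** * Perturbing a point of the polyhedron *)

Section Perturbation.
Variables (R : realType).

Lemma small_step (I : finType) (s c : I -> R) : (forall i, 0 < s i) ->
  exists2 eps, 0 < eps & forall e i, 0 <= e <= eps -> e * c i <= s i.
Proof.
move=> s_gt0; pose K := \sum_i `|c i| / s i.
(* [K] dominates every ratio [|c i| / s i], so one step size serves all indices. *)
have K0 : 0 <= K by apply: sumr_ge0 => i _; rewrite divr_ge0 // ltW.
exists (1 + K)^-1 => [|e i /andP[e0 eK]]; first by rewrite invr_gt0; lra.
have cK : `|c i| <= K * s i.
  rewrite -ler_pdivrMr // /K (bigD1 i) //= lerDl.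
  by apply: sumr_ge0 => j _; rewrite divr_ge0 // ltW.
apply: le_trans (ler_wpM2l e0 (ler_norm _)) _.
apply: le_trans (ler_wpM2r (normr_ge0 _) eK) _.
rewrite mulrC ler_pdivrMr; last by lra.
by apply: le_trans cK _; have := s_gt0 i; nra.
Qed.

Variables (n : nat) (A : finType).
Implicit Types (x d : dvec R n A) (t : 'I_n -> R).
Implicit Types (y : n.-tupleprod (diamond A)).

Definition dir_at d t (i : 'I_n) (u : diamond A) : R :=
  match u with DBot => 0 | DAtom a => d (i, a) | DTop => t i end.

Definition dir_val d t y : R := \sum_(i < n) dir_at d t i (tnth y i).

Definition tight (f : n.-tupleprod (diamond A) -> int) x y : bool :=
  dval x y == (f y)%:~R.

(** [t i] bounds from above the growth rate of [max_pair x i] along [d]; only pairs attaining the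
    maximum matter for small steps. *)
Definition tight_dir f x d t : Prop :=
  (forall i a b, a != b -> x (i, a) + x (i, b) = max_pair x i ->
     d (i, a) + d (i, b) <= t i)
  /\ (forall y, tight f x y -> dir_val d t y <= 0).

Lemma tight_dir_PM f x d t : (1 < #|A|)%N -> PM f x -> tight_dir f x d t ->
  exists2 eps, 0 < eps &
    forall e, 0 <= e <= eps -> PM f [ffun p => x p + e * d p].
Proof.
move=> A1 xP [dpair dtight].
(* [small_step] needs positive slacks, so pairs without slack get the dummy value 1; [dpair] handles
   them. *)
pose sp (q : 'I_n * (A * A)) :=
  let v := max_pair x q.1 - (x (q.1, q.2.1) + x (q.1, q.2.2)) in
  if 0 < v then v else 1.
have sp_gt0 q : 0 < sp q by rewrite /sp; case: ifP.
have [e1 e1_gt0 He1] :=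
  small_step (fun q => d (q.1, q.2.1) + d (q.1, q.2.2) - t q.1) sp_gt0.
pose sy y := let v := (f y)%:~R - dval x y in if 0 < v then v else 1.
have sy_gt0 y : 0 < sy y by rewrite /sy; case: ifP.
have [e2 e2_gt0 He2] := small_step (dir_val d t) sy_gt0.
exists (Num.min e1 e2) => [|e]; first by rewrite lt_min e1_gt0.
rewrite le_min => /and3P[e_ge0 le_e1 le_e2] y.
set x' := [ffun p => _].
have max_le i : max_pair x' i <= max_pair x i + e * t i.
  have [a [b [nab ->]]] := max_pair_attained x' i A1.
  rewrite !ffunE; have := max_pair_ge x i nab.
  rewrite le_eqVlt => /orP[/eqP xab|xab].
    by have := ler_wpM2l e_ge0 (dpair _ _ _ nab xab); lra.
  have := He1 e (i, (a, b)); rewrite e_ge0 le_e1 /sp /= subr_gt0 xab.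
  by move/(_ isT); lra.
have le_y : dval x' y <= dval x y + e * dir_val d t y.
  rewrite /dval /dir_val mulr_sumr -big_split; apply: ler_sum => i _ /=.
  by case: (tnth y i) => [|a|] //=; rewrite ?mulr0 ?addr0 ?ffunE.
apply: le_trans le_y _.
have := xP y; rewrite le_eqVlt => /orP[ty|lty].
  by have := ler_wpM2l e_ge0 (dtight _ ty); move/eqP: ty => ->; lra.
have := He2 e y; rewrite e_ge0 le_e2 /sy subr_gt0 lty.
by move/(_ isT); lra.
Qed.

(** Otherwise [x] would be the midpoint of two other points of [PM f]. The maximum is only piecewise
    linear, so [d] and [- d] may have unrelated rates [t] and [t']. *)
Lemma vertex_tight_dir f x d t t' : (1 < #|A|)%N -> vertex (PM f) x ->
  tight_dir f x d t -> tight_dir f x (- d) t' -> forall p, d p = 0.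
Proof.
move=> A1 [xP x_vert] /(tight_dir_PM A1 xP)[e1 e1_gt0 P1].
move=> /(tight_dir_PM A1 xP)[e2 e2_gt0 P2] p.
pose e := Num.min e1 e2.
have e_gt0 : 0 < e by rewrite lt_min e1_gt0.
have le_e1 : 0 <= e <= e1 by rewrite ltW // ge_min lexx.
have le_e2 : 0 <= e <= e2 by rewrite ltW // ge_min lexx orbT.
have [||+ _] := x_vert _ _ 2^-1 (P1 _ le_e1) (P2 _ le_e2).
- by lra.
- by apply/ffunP => q; rewrite !ffunE; lra.
move/ffunP/(_ p); rewrite ffunE => /eqP.
by rewrite addrC -subr_eq0 addrK mulf_eq0 gt_eqF //= => /eqP.
Qed.

Lemma vertex_tight_dir_eq f x d t : (1 < #|A|)%N -> vertex (PM f) x ->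
    (forall i a b, a != b -> x (i, a) + x (i, b) = max_pair x i ->
       d (i, a) + d (i, b) = t i) ->
    (forall y, tight f x y -> dir_val d t y = 0) ->
  forall p, d p = 0.
Proof.
move=> A1 xV dpair dtight.
apply: (@vertex_tight_dir f x d t (fun i => - t i)) => //; split.
- by move=> i a b nab xab; rewrite dpair.
- by move=> y ty; rewrite dtight.
- by move=> i a b nab xab; rewrite !ffunE -(dpair _ _ _ nab xab); lra.
- move=> y ty; rewrite -oppr_ge0 -(dtight y ty) -sumrN /dir_val le_eqVlt.
  apply/orP; left; apply/eqP/eq_bigr => i _.
  by case: (tnth y i) => [|a|] /=; rewrite ?ffunE ?opprK ?oppr0.
Qed.

End Perturbation.

(** * The lattice of tight elements *)

Section TightLattice.
Variables (R : realType) (n : nat) (A : finType).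
Variables (f : n.-tupleprod (diamond A) -> int) (x : dvec R n A).
Hypotheses (f_sub : submodular f) (xP : PM f x).

(** Comparable elements give equality; for distinct atoms this is the bound of a pair sum by the
    maximum. *)
Lemma dval_at_supermodular i (u v : diamond A) :
  dval_at x i u + dval_at x i v
    <= dval_at x i (u `&` v)%O + dval_at x i (u `|` v)%O.
Proof.
change ((u `&` v)%O) with (diamond_meet u v).
change ((u `|` v)%O) with (diamond_join u v).
case: u v => [|a|] [|b|] //=; rewrite ?addr0 ?add0r //; last by rewrite addrC.
by case: eqVneq => [->//|nab] /=; rewrite add0r max_pair_ge.
Qed.

(** Submodularity of [f] forces the nonnegative coordinatewise gaps of supermodularity to sum to 0,
    so each of them vanishes. *)
Lemma tight_lattice s t : tight f x s -> tight f x t ->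
  [/\ tight f x (s `&` t)%O, tight f x (s `|` t)%O &
      forall i, dval_at x i (tnth s i) + dval_at x i (tnth t i) =
        dval_at x i (tnth s i `&` tnth t i)%O
        + dval_at x i (tnth s i `|` tnth t i)%O].
Proof.
move=> /eqP ts /eqP tt.
pose gap i := dval_at x i (tnth s i `&` tnth t i)%O
  + dval_at x i (tnth s i `|` tnth t i)%O
  - (dval_at x i (tnth s i) + dval_at x i (tnth t i)).
have gap_ge0 i : 0 <= gap i by rewrite subr_ge0 dval_at_supermodular.
have sum_gap : dval x (s `&` t)%O + dval x (s `|` t)%O
    = dval x s + dval x t + \sum_i gap i.
  rewrite /dval -!big_split; apply: eq_bigr => i _.
  by rewrite tnth_meet tnth_join /gap /= [RHS]addrC subrK.
have sum_gap_ge0 : 0 <= \sum_i gap i by apply: sumr_ge0.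
have fst : (f (s `&` t)%O)%:~R + (f (s `|` t)%O)%:~R
    <= (f s)%:~R + (f t)%:~R :> R by rewrite -!intrD ler_int.
have xI := xP (s `&` t)%O; have xU := xP (s `|` t)%O.
split; [by apply/eqP; lra | by apply/eqP; lra | move=> i].
have /eqP : \sum_i gap i = 0 by lra.
rewrite psumr_eq0 // => /allP/(_ i); rewrite mem_index_enum subr_eq0.
by move=> /(_ isT)/eqP.
Qed.

Lemma tight_atoms s t i a b : tight f x s -> tight f x t ->
  tnth s i = DAtom a -> tnth t i = DAtom b -> a != b ->
  x (i, a) + x (i, b) = max_pair x i.
Proof.
move=> ts tt sa tb nab; have [_ _ /(_ i)] := tight_lattice ts tt.
rewrite sa tb.
change (DAtom a `&` DAtom b)%O with (diamond_meet (DAtom a) (DAtom b)).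
change (DAtom a `|` DAtom b)%O with (diamond_join (DAtom a) (DAtom b)).
by rewrite /= (negPf nab) /= add0r.
Qed.

End TightLattice.

(** * Coordinates of a vertex *)

Section Vertex.
Variables (R : realType) (n : nat) (A : finType).
Variables (f : n.-tupleprod (diamond A) -> int) (x : dvec R n A).
Hypotheses (A_gt2 : (2 < #|A|)%N) (f_sub : submodular f).
Hypothesis (x_vert : vertex (PM f) x).

Let A_gt1 : (1 < #|A|)%N. Proof. exact: ltnW. Qed.
Let xP : PM f x. Proof. by case: x_vert. Qed.

Lemma tight_top_at i : exists2 y, tight f x y & tnth y i = DTop.
Proof.
suff /existsP[y /andP[ty /eqP yi]] :
    [exists y, tight f x y && (tnth y i == DTop)].
  by exists y.
apply: contraT => /existsPn noTop.
have {}noTop y : tight f x y -> tnth y i <> DTop.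
  by move=> ty yi; have := noTop y; rewrite ty yi eqxx.
(* Two distinct atoms at [i] in tight elements would have a tight join with top at [i], so one of
   [a0], [b0] is absent. *)
have [b no_b] : exists b, forall y, tight f x y -> tnth y i <> DAtom b.
  have [a0 [b0 [_ _ nab]]] := card_gt1P A_gt1.
  have [/existsP[y /andP[ty /eqP ya]]|] :=
      boolP [exists y, tight f x y && (tnth y i == DAtom a0)].
    exists b0 => z tz zb; have [_ tj _] := tight_lattice f_sub xP ty tz.
    apply: (noTop _ tj); rewrite tnth_join ya zb.
    change (DAtom a0 `|` DAtom b0)%O with (
      diamond_join (DAtom a0) (DAtom b0)).
    by rewrite /= (negPf nab).
  move=> /existsPn no; exists a0 => y ty ya.
  by have := no y; rewrite ty ya eqxx.
pose d : dvec R n A := [ffun q => (q == (i, b))%:R].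
have dz (d' : dvec R n A) (t : 'I_n -> R) y : tight f x y ->
    (forall q, q != (i, b) -> d' q = 0) -> (forall j, j != i -> t j = 0) ->
    dir_val d' t y = 0.
  move=> ty d0 t0; rewrite /dir_val big1 // => j _.
  case yj: (tnth y j) => [|a|] //=.
    by apply: d0; apply/eqP => -[ji ab]; apply: (no_b y ty); rewrite -ji -ab.
  by apply: t0; apply/eqP => ji; apply: (noTop y ty); rewrite -ji.
(* Raising only [x (i, b)] raises the maximum at rate at most 1; lowering it never raises the
   maximum. *)
have := @vertex_tight_dir _ _ _ f x d (fun j => (j == i)%:R) (fun=> 0)
  A_gt1 x_vert.
have nn j a c : a != c -> ~~ (((j, a) == (i, b)) && ((j, c) == (i, b))).
  move=> nac; apply/negP => /andP[/eqP[_ ab] /eqP[_ cb]].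
  by rewrite ab cb eqxx in nac.
have D1 : tight_dir f x d (fun j => (j == i)%:R).
  split=> [j a c nac _|y ty].
    rewrite !ffunE; have := nn j _ _ nac; rewrite !xpair_eqE.
    by case: (j == i); case: (a == b); case: (c == b) => //= _;
      rewrite ?addr0 ?add0r ?ler01.
  rewrite dz // => [q nq|j nj]; first by rewrite ffunE (negPf nq).
  by rewrite (negPf nj).
have D2 : tight_dir f x (- d) (fun=> 0).
  split=> [j a c _ _|y ty].
    by rewrite !ffunE -opprD oppr_le0 addr_ge0 ?ler0n.
  by rewrite dz // => q nq; rewrite !ffunE (negPf nq) oppr0.
by move=> /(_ D1 D2 (i, b)); rewrite ffunE eqxx => /eqP; rewrite oner_eq0.
Qed.

(** Otherwise [x (i, r)] could move both ways, affecting neither the maximum at [i] nor any tight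
    constraint. *)
Lemma tight_atom_of_low i r :
    (forall c, c != r -> x (i, r) + x (i, c) <> max_pair x i) ->
  exists2 y, tight f x y & tnth y i = DAtom r.
Proof.
move=> r_low.
suff /existsP[y /andP[ty /eqP yi]] :
    [exists y, tight f x y && (tnth y i == DAtom r)].
  by exists y.
apply: contraT => /existsPn no.
pose d : dvec R n A := [ffun q => (q == (i, r))%:R].
have := @vertex_tight_dir_eq _ _ _ f x d (fun=> 0) A_gt1 x_vert.
have D1 j a c : a != c -> x (j, a) + x (j, c) = max_pair x j ->
    d (j, a) + d (j, c) = 0.
  move=> nac xac; rewrite !ffunE !xpair_eqE.
  case: eqP => [ji|_]; last by rewrite addr0.
  rewrite ji in xac; case: (eqVneq a r) => [ar|_].
    by case: (r_low c); rewrite -?ar // eq_sym.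
  case: (eqVneq c r) => [cr|_]; last by rewrite addr0.
  by case: (r_low a); rewrite -?cr // addrC.
have D2 y : tight f x y -> dir_val d (fun=> 0) y = 0.
  move=> ty; rewrite /dir_val big1 // => j _.
  case yj: (tnth y j) => [|a|] //=; rewrite ffunE.
  case: eqP => // -[ji ar]; have := no y.
  by rewrite ty -ji yj ar eqxx.
by move=> /(_ D1 D2 (i, r)); rewrite ffunE eqxx => /eqP; rewrite oner_eq0.
Qed.

(** Let [a], [b] attain the maximum, [a] having the larger value. Every other atom is at most [b] in
    value, and those strictly below occur in tight elements but in no maximal pair, so at most one
    such [r] exists. The exceptional atom is [a] or [r]. *)
Lemma vertex_two_valued i :
  exists pb : A * R, forall q, q != pb.1 -> x (i, q) = pb.2.
Proof.
have [a [b [nab ab_max]]] : exists a b, a != b /\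
    (x (i, b) <= x (i, a) /\ max_pair x i = x (i, a) + x (i, b)).
  have [a [b [nab eab]]] := max_pair_attained x i A_gt1.
  case: (lerP (x (i, b)) (x (i, a))) => le_ab; first by exists a, b.
  by exists b, a; rewrite eq_sym nab addrC ltW.
have {ab_max}[le_ba max_ab] := ab_max.
have le_b c : c != a -> x (i, c) <= x (i, b).
  by move=> nca; have := max_pair_ge x i nca; rewrite max_ab addrC lerD2l.
have [/forallP all_b|] := boolP [forall c, (c != a) ==> (x (i, c) == x (i, b))].
  by exists (a, x (i, b)) => q nq; apply/eqP/(implyP (all_b q)).
rewrite negb_forall => /existsP[r]; rewrite negb_imply => /andP[nra xr].
have {xr}lt_r : x (i, r) < x (i, b) by rewrite lt_neqAle xr le_b.
have low s : s != a -> x (i, s) < x (i, b) ->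
    forall c, c != s -> x (i, s) + x (i, c) <> max_pair x i.
  move=> nsa lt_s c ncs; have [-> |nca] := eqVneq c a; first by lra.
  by have := le_b _ nca; lra.
have [y ty yr] := tight_atom_of_low (low _ nra lt_r).
have only_r z c : tight f x z -> tnth z i = DAtom c -> c = r.
  move=> tz zc; apply/eqP/negPn/negP => ncr.
  apply: (low _ nra lt_r _ ncr); apply: (tight_atoms f_sub xP ty tz yr zc).
  by rewrite eq_sym.
have others c : c != a -> c != r -> x (i, c) = x (i, b).
  move=> nca ncr; apply/eqP; rewrite eq_le le_b //= leNgt; apply/negP => lt_c.
  have [z tz zc] := tight_atom_of_low (low _ nca lt_c).
  by move/eqP: ncr; apply; apply: only_r tz zc.
have [eab|neab] := eqVneq (x (i, a)) (x (i, b)).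
  exists (r, x (i, b)) => q /= nqr.
  by have [->//|nqa] := eqVneq q a; apply: others.
(* Raising [a] and lowering all atoms but [a] and [r] keeps every tight
   constraint, because no tight element has an atom other than [r] at [i]. *)
pose d : dvec R n A := [ffun q =>
  if q.1 != i then 0 else if q.2 == a then 1 else if q.2 == r then 0 else -1].
have := @vertex_tight_dir_eq _ _ _ f x d (fun=> 0) A_gt1 x_vert.
have D1 j c c' : c != c' -> x (j, c) + x (j, c') = max_pair x j ->
    d (j, c) + d (j, c') = 0.
  move=> ncc xcc; rewrite !ffunE /=.
  have [ji|_] := eqVneq j i => /=; last by rewrite addr0.
  rewrite {}ji in xcc.
  have [ca|nca] := eqVneq c a; have [c'a|nc'a] := eqVneq c' a.
  - by rewrite ca c'a eqxx in ncc.
  - have [c'r|_] := eqVneq c' r; last by rewrite subrr.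
    by case: (low _ nra lt_r c); rewrite -?c'r // addrC.
  - have [cr|_] := eqVneq c r; last by rewrite addNr.
    by case: (low _ nra lt_r c'); rewrite -?cr // eq_sym.
  - by have := le_b _ nca; have := le_b _ nc'a; move/eqP: neab; lra.
have D2 z : tight f x z -> dir_val d (fun=> 0) z = 0.
  move=> tz; rewrite /dir_val big1 // => j _.
  case zj: (tnth z j) => [|c|] //=; rewrite ffunE /=.
  have [ji|//] := eqVneq j i; rewrite ji in zj.
  by rewrite (only_r _ _ tz zj) /= (negPf nra) eqxx.
by move=> /(_ D1 D2 (i, a)); rewrite ffunE /= !eqxx => /eqP;
  rewrite oner_eq0.
Qed.

End Vertex.

(** * Linear parametrisation of a two-valued point *)

Section TwoValued.
Variables (R : realType) (n : nat) (A : finType) (x : dvec R n A).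
Variables (p : 'I_n -> A) (b : 'I_n -> R).
Hypotheses (A_gt2 : (2 < #|A|)%N) (xb : forall i q, q != p i -> x (i, q) = b i).

(** Three atoms leave two besides [p i], so both [b i + b i] and [x (i, p i) + b i] occur as pair
    sums. *)
Lemma max_pair_two_valued i :
  max_pair x i = if b i < x (i, p i) then x (i, p i) + b i else b i + b i.
Proof.
have [q [q' [nq nq' nqq]]] : exists q q', [/\ q != p i, q' != p i & q != q'].
  have [a1 [a2 [a3 [_ [n12 n23 n31]]]]] := card_gt2P A_gt2.
  have [e1|ne1] := eqVneq a1 (p i).
    by exists a2, a3; split; rewrite // -e1 // eq_sym.
  have [e2|ne2] := eqVneq a2 (p i).
    by exists a1, a3; split; rewrite // -?e2 // eq_sym.
  by exists a1, a2.
have := max_pair_ge x i nqq; have := max_pair_ge x i nq.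
rewrite (xb nq) (xb nq') => ge1 ge2.
have [a [c [nac mac]]] := max_pair_attained x i (ltnW A_gt2).
have xa : x (i, a) = b i \/ a = p i.
  by have [ap|nap] := eqVneq a (p i); [right | left; apply: xb].
have xc : x (i, c) = b i \/ c = p i.
  by have [cp|ncp] := eqVneq c (p i); [right | left; apply: xb].
case: ltP => lt_b; case: xa => [xa|xa]; case: xc => [xc|xc];
  rewrite ?xa ?xc in mac nac *; rewrite ?eqxx // in nac; lra.
Qed.

(* At coordinate [i], the parameter [(i, true)] is the value at the
   exceptional atom [p i] and [(i, false)] the common value at all others;
   [(i, true)] is dropped when the two values agree. *)
Definition active : {set 'I_n * bool} :=
  [set e | ~~ e.2 || (x (e.1, p e.1) != b e.1)].

(** The value at the top is the linear branch of the maximum that is active at [x]. If the two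
    values agree, [p i] counts as an ordinary atom. *)
Definition coef (e : 'I_n * bool) (u : diamond A) : int :=
  let: (i, k) := e in
  if k then
    if x (i, p i) == b i then 0 else
    match u with
    | DBot => 0 | DAtom a => (a == p i)%:Z | DTop => (b i < x (i, p i))%R%:Z
    end
  else
    match u with
    | DBot => 0
    | DAtom a => (~~ ((x (i, p i) != b i) && (a == p i)))%:Z
    | DTop => if b i < x (i, p i) then 1 else 2
    end.

Definition param_val (w : 'I_n * bool -> R) i (u : diamond A) : R :=
  (coef (i, true) u)%:~R * w (i, true) + (coef (i, false) u)%:~R * w (i, false).

Definition params (e : 'I_n * bool) : R :=
  if e.2 then x (e.1, p e.1) else b e.1.

Lemma param_val_params i u : param_val params i u = dval_at x i u.
Proof.
rewrite /param_val /params /=; case: u => [|a|] /=.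
- by rewrite if_same !mul0r addr0.
- have [e|ne] := eqVneq (x (i, p i)) (b i);
    have [->|na] := eqVneq a (p i) => /=;
    rewrite ?mul0r ?mul1r ?add0r ?addr0 //; by rewrite xb.
- by rewrite max_pair_two_valued; case: ltgtP => [lt|lt|e] /=; ring.
Qed.

(** This makes every parameter vector [w], not just that of [x], a candidate direction for
    [vertex_tight_dir_eq]. *)
Lemma param_val_pair w i a c : a != c -> x (i, a) + x (i, c) = max_pair x i ->
  param_val w i (DAtom a) + param_val w i (DAtom c) = param_val w i DTop.
Proof.
move=> nac; rewrite max_pair_two_valued /param_val /=.
have [ea|na] := eqVneq a (p i); have [ec|nc] := eqVneq c (p i).
- by rewrite ea ec eqxx in nac.
- by rewrite ea (xb nc); case: ltgtP => [lt|lt|e] //= xx; try ring; lra.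
- by rewrite ec (xb na); case: ltgtP => [lt|lt|e] //= xx; try ring; lra.
- by rewrite (xb na) (xb nc); case: ltgtP => [lt|lt|e] //= xx; try ring; lra.
Qed.

Definition coef_row (y : n.-tupleprod (diamond A)) :
    {ffun 'I_n * bool -> int} :=
  [ffun e => coef e (tnth y e.1)].

Lemma rdot_coef_row w y :
  rdot active (coef_row y) w = \sum_i param_val w i (tnth y i).
Proof.
rewrite /rdot big_mkcond /=; pose G i k : R :=
  if (i, k) \in active then (coef_row y (i, k))%:~R * w (i, k) else 0.
transitivity (\sum_i \sum_k G i k).
  by rewrite pair_bigA; apply: eq_bigr => -[].
apply: eq_bigr => i _; rewrite big_bool /G /param_val !inE !ffunE /=.
by case: eqP => //= _; rewrite mul0r.
Qed.

(** A coefficient may drop from an atom to the top, so it is not monotone itself; assigning 2 to the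
    top gives a potential that bounds its variation. *)
Lemma coef_variation e (u v : diamond A) : (u <= v)%O ->
  `|coef e v - coef e u|
    <= (if v is DTop then 2 else coef e v)
       - (if u is DTop then 2 else coef e u).
Proof.
change ((u <= v)%O) with (diamond_le u v).
have [->|nuv] := eqVneq u v; first by rewrite !subrr normr0.
case: e u v nuv => i k [|a|] [|c|] //= nuv => [_|_|/eqP ac|_];
  rewrite ?ac ?eqxx // in nuv *; case: k; case: (ltgtP (b i)) => _ //=;
  by case: (_ == p i).
Qed.

End TwoValued.

(** * Half-integrality of the vertices *)

Theorem theorem6 (R : realType) (A : finType) (hA : (3 <= #|A|)%N)
    (n : nat) (hn : (1 <= n)%N)
    (f : n.-tupleprod (diamond A) -> int) (hf : submodular f)
    (x : dvec R n A) (hx : vertex (PM f) x) (i : 'I_n) (a : A) :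
  exists k : int, x (i, a) = k%:~R / 2.
Proof.
have xP := hx.1.
have [pb Hpb] := fin_all_exists (vertex_two_valued hA hf hx).
pose p j := (pb j).1; pose b j := (pb j).2.
have xb j q : q != p j -> x (j, q) = b j by apply: Hpb.
pose T := tight f x.
have Tmeet y z : T y -> T z -> T (y `&` z)%O.
  by move=> ty tz; have [] := tight_lattice hf xP ty tz.
have Tjoin y z : T y -> T z -> T (y `|` z)%O.
  by move=> ty tz; have [] := tight_lattice hf xP ty tz.
have [y1 Ty1 _] := tight_top_at hA hf hx i.
have [y0 Ty0 y0_min] := exists_least Tmeet Ty1.
have [top Ttop top_max] := exists_greatest Tjoin Ty1.
have topE j : tnth top j = DTop.
  have [y ty yj] := tight_top_at hA hf hx j.
  have := top_max _ ty; rewrite leEtprod => /forallP/(_ j); rewrite yj.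
  by case: (tnth top j).
have [s [ps Ts last_s]] := maximal_chain Ty0 Ttop top_max.
pose row := coef_row x p b; pose S := active x p b.
(* The row of [y0] is the difference from the all-bottom element, so the system determines all rows
   along the chain. *)
pose rows := row y0 :: pairmap (fun u v => row v - row u) y0 s.
have rdotD w y z :
    rdot S (row z - row y) w = rdot S (row z) w - rdot S (row y) w.
  by rewrite /rdot -sumrB; apply: eq_bigr => e _; rewrite !ffunE intrB mulrBl.
have TinT z : z \in y0 :: s -> T z.
  by rewrite in_cons => /orP[/eqP->//|]; apply: (allP Ts).
have sys : half_integral_system rows S (params x p b).
  split.
  - move=> e _; rewrite big_cons.
    pose phi (y : n.-tupleprod (diamond A)) : int :=
      if tnth y e.1 is DTop then 2 else coef x p b e (tnth y e.1).
    have := @sum_pairmap_le _ _ (fun u v => row v - row u) (cover_in T)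
      (fun r : {ffun _ -> int} => `|r e|) phi y0 s.
    rewrite last_s [phi top]/phi topE => le_s.
    have le_y0 : `|row y0 e| <= phi y0.
      have := @coef_variation _ _ _ x p b e DBot (tnth y0 e.1) (diamond_le0x _).
      by rewrite ffunE /phi; case: (e) => j [] /=; rewrite ?if_same !subr0.
    have {}le_s : \sum_(r <- pairmap (fun u v => row v - row u) y0 s) `|r e|
        <= 2 - phi y0.
      apply: le_s ps => u v /andP[le_uv _]; rewrite !ffunE.
      apply: coef_variation.
      by move: le_uv; rewrite leEtprod => /forallP/(_ e.1).
    by apply: le_trans (lerD le_y0 le_s) _; rewrite addrC subrK.
  - move=> w w0.
    (* A kernel vector [w] becomes a direction [d] with rates [t]; it must vanish because [x] is a
       vertex. *)
    pose d : dvec R n A := [ffun q => param_val x p b w q.1 (DAtom q.2)].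
    pose t j := param_val x p b w j DTop.
    pose D y := rdot S (row y) w.
    have DE y : D y = dir_val d t y.
      rewrite /D rdot_coef_row; apply: eq_bigr => j _.
      case: (tnth y j) => [|c|] //=; last by rewrite ffunE.
      by rewrite /param_val /= if_same !mul0r addr0.
    have dpair j c c' : c != c' -> x (j, c) + x (j, c') = max_pair x j ->
        d (j, c) + d (j, c') = t j.
      by move=> ncc xcc; rewrite !ffunE; apply: param_val_pair.
    have Dmod y z : T y -> T z -> D (y `&` z)%O + D (y `|` z)%O = D y + D z.
      move=> ty tz; rewrite !DE /dir_val -!big_split; apply: eq_bigr => j _ /=.
      rewrite tnth_meet tnth_join.
      case yj: (tnth y j) => [|c|]; case zj: (tnth z j) => [|c'|];
        rewrite /Order.meet /Order.join /= ?addr0 ?add0r //; last first.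
        by rewrite addrC.
      (* Modularity could fail only at distinct atoms, and in tight elements these form a maximal
         pair. *)
      case: eqVneq => [->//|ncc] /=; rewrite add0r (dpair _ _ _ ncc) //.
      exact: (tight_atoms hf xP ty tz yj zj).
    have D0 : {in y0 :: s, forall z, D z = 0}.
      apply: (@pairmap_eq0 _ _ (fun u v => row v - row u) _
        (fun r => rdot S r w)).
      - by move=> u v; rewrite rdotD.
      - by apply: w0; rewrite mem_head.
      - by move=> r rs; apply: w0; rewrite in_cons rs orbT.
    have DT y : tight f x y -> dir_val d t y = 0.
      move=> ty; rewrite -DE.
      have := modular_chain_eq0 Tmeet Tjoin Dmod Ty0 Ts ps D0 ty.
      rewrite last_s (meet_idPl (top_max _ ty)) (meet_idPr (y0_min _ ty)) => ->.
      by rewrite D0 ?mem_head.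
    have d0 := vertex_tight_dir_eq (ltnW hA) hx dpair DT.
    (* [w (j, true)] is read off from [d] at [p j], and [w (j, false)] at any other atom. *)
    move=> [j k]; rewrite inE /=; case: k => /= [ne|_].
      have := d0 (j, p j); rewrite ffunE /param_val /= (negPf ne) eqxx /=.
      by rewrite mul1r mul0r addr0.
    have [q nq] : exists q, q != p j.
      have [q [q' [_ _ nqq]]] := card_gt1P (ltnW hA).
      by have [e|] := eqVneq q (p j); [exists q'; rewrite -e eq_sym | exists q].
    have := d0 (j, q); rewrite ffunE /param_val /= (negPf nq) andbF if_same /=.
    by rewrite mul1r mul0r add0r.
  (* Tightness makes the right-hand side a value of [f], hence an integer. *)
  - have int_row y : T y -> rdot S (row y) (params x p b) \is a Num.int.
      move=> /eqP ty; rewrite rdot_coef_row.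
      under eq_bigr => j _ do rewrite (param_val_params hA xb).
      by rewrite -/(dval x y) ty intr_int.
    move=> r; rewrite in_cons => /orP[/eqP->|/mem_pairmap[u [v [us vs ->]]]].
      exact: int_row.
    by rewrite rdotD rpredB // int_row // TinT.
have half := half_integral sys.
have xia e : e \in S -> params x p b e = x (i, a) ->
    exists k : int, x (i, a) = k%:~R / 2.
  move=> eS <-; have /intrP[k ek] := half _ eS.
  by exists k; rewrite -ek mulrAC divff ?mul1r // pnatr_eq0.
have [eap|nap] := eqVneq a (p i); last first.
  by apply: (xia (i, false)); rewrite ?inE //= xb.
have [exb|nxb] := eqVneq (x (i, p i)) (b i).
  by apply: (xia (i, false)); rewrite ?inE //= eap exb.
by apply: (xia (i, true)); rewrite ?inE //= eap.
Qed.
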